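(* Let $g$ be a non-empty list of natural numbers with $0$ not occurring in $g$, and let $M$ be the submonoid of $(\mathbb{N},+)$ generated by the elements of $g$. Let $k \in \mathbb{N}$ and let $x \in M$ with $x < |\mathrm{lgen}_{|g|-1}(k)| \cdot \min g$. Then there exists $n < k$ such that $\mathrm{mgen}_g(n) = x$.
   Context: For $m \in \mathbb{N}$, $\mathrm{next}_m$ on lists of naturals is defined by: $\mathrm{next}_m([\,]) = [0]$; $\mathrm{next}_m(h :: t) = (h+1) :: t$ if $h < m$; if $h \ge m$: $\mathrm{next}_m(h :: t) = [\,]$ when $\mathrm{next}_m(t) = [\,]$, and $=x :: x :: t'$ when $\mathrm{next}_m(t) = x :: t'$. $\mathrm{lgen}_m(0) = [\,]$, $\mathrm{lgen}_m(x+1) = \mathrm{next}_m(\mathrm{lgen}_m(x))$. For a list $g$, $g[i]$ is its $i$-th element (indexing from $0$), $|g|$ its length, and $\min g$ its minimum element. Define $\mathrm{mgen}_g(n) = \sum_{i \in \mathrm{lgen}_{|g|-1}(n)} g[i]$, the sum running over the elements of the list $\mathrm{lgen}_{|g|-1}(n)$ with multiplicity. *)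

(* Defs.v *)
From mathcomp Require Import all_boot.
Set Implicit Arguments.
Unset Strict Implicit.
Unset Printing Implicit Defensive.

Fixpoint next (m : nat) (s : seq nat) : seq nat :=
  if s is h :: t then
    if h < m then h.+1 :: t
    else if next m t is x :: t' then [:: x, x & t'] else [::]
  else [:: 0].

Definition lgen (m x : nat) : seq nat := iter x (next m) [::].

Definition mgen (g : seq nat) (n : nat) : nat :=
  \sum_(i <- lgen (size g - 1) n) nth 0 g i.

(* The fold starts from the head of g, itself an element of g, because nat has
   no neutral element for minn; minseq [::] = 0 is a junk value. *)
Definition minseq (g : seq nat) : nat := \big[minn/head 0 g]_(a <- g) a.

Inductive submonoid_gen (g : seq nat) : nat -> Prop :=
| submonoid_gen0 : submonoid_gen g 0
| submonoid_gen_mem a : a \in g -> submonoid_gen g a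
| submonoid_genD a b :
    submonoid_gen g a -> submonoid_gen g b -> submonoid_gen g (a + b).

(* Main.v *)
Require Import Defs.
From mathcomp Require Import all_boot.

(* The iterates of [next m] enumerate, by non-decreasing length, all
   non-increasing lists with entries at most m. If t is enumerated then so is
   every h :: t with head t <= h <= m: going from t to its successor x :: t', the
   run ending at m :: t is followed by x :: x :: t', whose head then climbs to m.
   An x in M is the sum of g over such an index list, whose length is at most
   x / min g, hence smaller than that of lgen k; so it occurs before k. *)

(* [path.next] would otherwise shadow [Defs.next]. *)
Local Notation next := Defs.next.

Lemma next_neq_nil m s : next m s != [::].
Proof. by elim: s => //= h t; case: ifP => // _; case: (next m t). Qed.

Lemma head_next_le m s : head 0 (next m s) <= m.
Proof.
elim: s => //= h t; case: ifP => //= _.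
by case: (next m t).
Qed.

Lemma head_lgen_le m n : head 0 (lgen m n) <= m.
Proof. by case: n => // n; apply: head_next_le. Qed.

(** As [next m s] is never empty, the [[::]] branch of [next] is not reached. *)
Lemma next_cons_max m s : next m (m :: s) = head 0 (next m s) :: next m s.
Proof. by rewrite /= ltnn; case: (next m s) (next_neq_nil m s). Qed.

Lemma leq_size_next m s : size s <= size (next m s).
Proof.
elim: s => //= h t; case: ifP => //= _.
by case: (next m t) (next_neq_nil m t).
Qed.

Lemma leq_size_lgen m n k : n <= k -> size (lgen m n) <= size (lgen m k).
Proof.
move/subnKC <-; elim: (k - n) => [|d IH]; first by rewrite addn0.
by rewrite addnS; apply: leq_trans IH (leq_size_next _ _).
Qed.

(** Below [m], each step only increments the head. *)
Lemma lgen_incr_head m n a s h :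
  lgen m n = a :: s -> a <= h <= m -> exists n', lgen m n' = h :: s.
Proof.
move=> en; elim: h => [|h IH] /andP[]; first by rewrite leqn0 => /eqP<-; exists n.
rewrite leq_eqVlt => /predU1P[<- _|le_ah lt_hm]; first by exists n.
have [|n' en'] := IH; first by rewrite -ltnS le_ah ltnW.
by exists n'.+1; rewrite /lgen iterS -/(lgen m n') en' /= lt_hm.
Qed.

Lemma lgen_cons m n h :
  head 0 (lgen m n) <= h <= m -> exists n', lgen m n' = h :: lgen m n.
Proof.
elim: n h => [|n IH] h; first exact: (@lgen_incr_head m 1).
have [|n' en'] := IH m; first by rewrite head_lgen_le leqnn.
(* At [n'.+1] stands [lgen m n.+1] with its head repeated. *)
by apply: (@lgen_incr_head m n'.+1); rewrite /lgen iterS -/(lgen m n') en' next_cons_max.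
Qed.

Lemma lgen_surj m s :
  sorted geq s -> all (leq^~ m) s -> exists n, lgen m n = s.
Proof.
elim: s => [|h t IH] /= st; first by exists 0.
case/andP=> le_hm /(IH (path_sorted st))[n en].
rewrite -en; apply: lgen_cons; rewrite en le_hm andbT.
by case: t st {IH en} => //= a t /andP[].
Qed.

Lemma submonoid_gen_indices g x : submonoid_gen g x ->
  exists2 s, all (gtn (size g)) s & \sum_(i <- s) nth 0 g i = x.
Proof.
elim=> [|a ag|a b _ [s sg <-] _ [t tg <-]].
- by exists [::]; rewrite ?big_nil.
- by exists [:: index a g]; rewrite /= ?index_mem ?ag // big_seq1 nth_index.
- by exists (s ++ t); rewrite ?all_cat ?sg // big_cat.
Qed.

Lemma minseq_le g a : a \in g -> minseq g <= a.
Proof.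
(* The seed [head 0 g] varies with [g], so the induction is over an arbitrary seed [z]. *)
rewrite /minseq; elim: g (head 0 g) => //= b g IH z.
rewrite inE big_cons geq_min => /predU1P[->|/IH->]; first by rewrite leqnn.
by rewrite orbT.
Qed.

Lemma leq_size_minseq g s : all (gtn (size g)) s ->
  size s * minseq g <= \sum_(i <- s) nth 0 g i.
Proof.
elim: s => [|i s IH] //= /andP[lt_ig /IH le_s].
by rewrite big_cons mulSn leq_add // minseq_le // mem_nth.
Qed.

Theorem theorem9 (g : seq nat) (g_neq0 : g <> [::]) (g_pos : 0 \notin g)
    (k x : nat) (xM : submonoid_gen g x)
    (x_lt : x < size (lgen (size g - 1) k) * minseq g) :
  exists n : nat, n < k /\ mgen g n = x.
Proof.
have [s sg sum_s] := submonoid_gen_indices _ _ xM.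
have [||n en] := lgen_surj (size g - 1) (sort geq s).
- by apply: sort_sorted => i j; apply: leq_total.
- rewrite all_sort; apply: sub_all sg => i /= lt_ig.
  (* The index [i] itself witnesses [0 < size g]. *)
  by rewrite leq_subRL ?add1n //; apply: leq_ltn_trans lt_ig.
exists n; split; last first.
  by rewrite /mgen en -sum_s; apply: perm_big; rewrite perm_sort.
(* If [k <= n], the list at [k] is no longer than [s]; but [size s * minseq g <= x] and [x_lt] make
   it strictly longer. *)
rewrite ltnNge; apply/negP => /(leq_size_lgen (size g - 1)).
rewrite en size_sort => le_ks.
have := leq_ltn_trans (leq_size_minseq _ _ sg); rewrite sum_s => /(_ _ x_lt).
by rewrite ltnNge leq_mul2r le_ks orbT.
Qed.
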